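(* Let $\Omega\subset\mathbb{R}^n$ be a Borel set and let $\mu\in\mathrm{ba}(\Omega,\mathcal{B}(\Omega),\mathcal{L}^n)$. If $\operatorname{core}\mu\cap\Omega$ is an $\mathcal{L}^n$-null set, then $\mu$ is pure.
   Context: $\mathcal{B}(\Omega)$ is the Borel $\sigma$-algebra of $\Omega$ and $\mathcal{L}^n$ is Lebesgue measure. A measure is a finitely additive real-valued set function; a $\sigma$-measure is a countably additive one. $\mathrm{ba}(\Omega,\mathcal{B}(\Omega))$ is the vector lattice (with setwise order) of bounded measures on $\mathcal{B}(\Omega)$, $|\mu|$ is the total variation, and $(\mu\wedge\nu)(A)=\inf\{\mu(A')+\nu(A\setminus A'):A'\in\mathcal{B}(\Omega),A'\subset A\}$. $\mathrm{ba}(\Omega,\mathcal{B}(\Omega),\mathcal{L}^n)$ is the set of $\mu\in\mathrm{ba}(\Omega,\mathcal{B}(\Omega))$ such that $\mathcal{L}^n(B)=0$ implies $\mu(B)=0$ for all $B\in\mathcal{B}(\Omega)$. $\mu$ is pure if $|\mu|\wedge|\nu|=0$ for all bounded $\sigma$-measures $\nu$ on $\mathcal{B}(\Omega)$. The core of $\mu$ is $$\operatorname{core}\mu:=\{x\in\mathbb{R}^n : |\mu|(V\cap\Omega)>0 \text{ for all open } V\subset\mathbb{R}^n \text{ with } x\in V\}.$$ *)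

(* Defs.v *)
From HB Require Import structures.
From mathcomp Require Import all_boot all_order all_algebra.
From mathcomp Require Import all_classical all_reals all_analysis.

Set Implicit Arguments.
Unset Strict Implicit.
Unset Printing Implicit Defensive.

Import Order.TTheory GRing.Theory Num.Theory.
Import numFieldNormedType.Exports.

Local Open Scope classical_set_scope.
Local Open Scope ring_scope.
Local Open Scope ereal_scope.

Section lebesgue_borel.
Context {R : realType} {n : nat}.
Implicit Types A Omega : set 'rV[R]_n.

Definition borel : set (set 'rV[R]_n) := <<s @open 'rV[R]_n >>.

Definition box (a b : 'rV[R]_n) : set 'rV[R]_n :=
  [set x | forall i : 'I_n, (a ord0 i < x ord0 i <= b ord0 i)%R].

(* The n-dimensional Lebesgue (outer) measure; on Borel sets it is L^n.
   Covers are indexed by a set D of naturals, so that finite and empty covers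
   are allowed: for n = 0 every box is the one-point space, of volume 1, and
   set0 can only be covered by the empty family. *)
Definition lebesgue_rV A : \bar R :=
  ereal_inf [set v | exists (D : set nat) (a b : nat -> 'rV[R]_n),
    [/\ forall k i, D k -> (a k ord0 i <= b k ord0 i)%R,
        A `<=` \bigcup_(k in D) box (a k) (b k) &
        v = \esum_(k in D) (\prod_(i < n) (b k ord0 i - a k ord0 i))%R%:E]].

(* R^n, whose measurable sets are taken to be the Borel sets included in Omega.
   For a Borel set Omega these are exactly the elements of B(Omega), so that a
   set function on B(Omega) is a set function on (borel_on Omega); using R^n
   as carrier keeps the case Omega = set0 (measurable types are pointed). *)
Definition borel_on Omega : Type := 'rV[R]_n.

Fact borel_on_display Omega : measure_display.
Proof. exact: default_measure_display. Qed.

Section sigma_ring.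
Variable Omega : set 'rV[R]_n.

Let mborel : set (set 'rV[R]_n) := [set B | borel B /\ B `<=` Omega].

Let borel_on0 : mborel set0.
Proof. by split; [exact: sigma_algebra0|exact: sub0set]. Qed.

Let borel_onD : setD_closed mborel.
Proof.
move=> A B [bA AO] [bB _]; split; last by move=> x [/AO].
exact: (@measurableD _ (g_sigma_algebraType (@open 'rV[R]_n))).
Qed.

Let borel_on_bigcup (F : (set 'rV[R]_n)^nat) :
  (forall i, mborel (F i)) -> mborel (\bigcup_i F i).
Proof.
move=> mF; split; first by apply: sigma_algebra_bigcup => i; case: (mF i).
by move=> x [i _]; case: (mF i) => _; exact.
Qed.

HB.instance Definition _ := Pointed.copy (borel_on Omega) 'rV[R]_n.
HB.instance Definition _ := @isSigmaRing.Build (borel_on_display Omega)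
  (borel_on Omega) mborel borel_on0 borel_onD borel_on_bigcup.

End sigma_ring.

End lebesgue_borel.

(* In the library, {additive_charge set T -> \bar R} and
   {charge set T -> \bar R} are the finitely (resp. countably) additive
   functions on the measurable sets of T, with finite values of any sign. *)
Section set_functions.
Context {d : measure_display} {T : semiRingOfSetsType d} {R : realType}.
Implicit Types mu nu : set T -> \bar R.

Definition bounded_set_function mu :=
  exists M : R, forall B, measurable B -> `|mu B| <= M%:E.

Definition set_function_variation mu (A : set T) : \bar R :=
  ereal_sup [set v | exists (F : (set T)^nat) (k : nat),
    [/\ forall i, measurable (F i), trivIset setT F,
        \big[setU/set0]_(i < k) F i = A & v = \sum_(i < k) `|mu (F i)|]].

Definition set_function_meet mu nu (A : set T) : \bar R :=
  ereal_inf [set v | exists A' : set T,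
    [/\ measurable A', A' `<=` A & v = mu A' + nu (A `\` A')]].

Definition pure mu :=
  forall nu : {charge set T -> \bar R}, bounded_set_function nu ->
  forall A, measurable A ->
    set_function_meet (set_function_variation mu) (set_function_variation nu) A = 0.

End set_functions.

Section core.
Context {R : realType} {n : nat} {Omega : set 'rV[R]_n}.
Implicit Types mu : set (borel_on Omega) -> \bar R.

Definition in_ba_lebesgue mu :=
  bounded_set_function mu /\
  forall B : set (borel_on Omega), measurable B -> lebesgue_rV B = 0 ->
    mu B = 0.

Definition core mu : set 'rV[R]_n :=
  [set x | forall V : set 'rV[R]_n, open V -> V x ->
    0 < set_function_variation mu (V `&` Omega)].

End core.

(* Main.v *)
Require Import Defs.
From HB Require Import structures.
From mathcomp Require Import all_boot all_order all_algebra.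
From mathcomp Require Import all_classical all_reals all_analysis.

Set Implicit Arguments.
Unset Strict Implicit.
Unset Printing Implicit Defensive.

Import Order.TTheory GRing.Theory Num.Theory.
Import numFieldNormedType.Exports.

Local Open Scope classical_set_scope.
Local Open Scope ring_scope.
Local Open Scope ereal_scope.

(* Off the core, mu vanishes locally, and the core meets Omega in an L^n-null
   set, so by second countability of R^n there are Borel sets E_m increasing to
   Omega with |mu|(E_m) = 0. Hence (|mu| /\ |nu|)(A) <= |nu|(A \ E_m), which
   tends to 0 when nu is countably additive. *)

(** * Total variation, its null sets and the meet *)

Section variation.
Context {d : measure_display} {T : ringOfSetsType d} {R : realType}.
Implicit Types (mu lam : set T -> \bar R) (A B : set T).

Lemma variation_ge0 mu A : measurable A -> 0 <= set_function_variation mu A.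
Proof.
move=> mA; apply: (@le_trans _ _ (\sum_(i < 2) `|mu (bigcup2 A set0 i)|)).
  by apply: sume_ge0 => i _; exact: abse_ge0.
apply: ereal_sup_ubound; exists (bigcup2 A set0), 2%N; split=> //.
- by move=> [|[|i]] /=.
- by rewrite -trivIset_bigcup2 setI0.
- by rewrite bigsetU_bigcup2 setU0.
Qed.

Lemma abse_le_variation mu A B : measurable A -> measurable B -> B `<=` A ->
  `|mu B| <= set_function_variation mu A.
Proof.
move=> mA mB BA.
apply: (@le_trans _ _ (\sum_(i < 2) `|mu (bigcup2 B (A `\` B) i)|)).
  by rewrite !big_ord_recl big_ord0 /= adde0 leeDl// abse_ge0.
apply: ereal_sup_ubound; exists (bigcup2 B (A `\` B)), 2%N; split=> //.
- by move=> [|[|i]] //=; exact: measurableD.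
- by rewrite -trivIset_bigcup2 setDIK.
- by rewrite bigsetU_bigcup2 setDUK.
Qed.

(** Each partition sum is bounded termwise by the sum for [lam], which additivity collapses to
    [lam A]. Used with [lam = 0] and with a measure coming from a Hahn decomposition. *)
Lemma variation_le mu lam A : measurable A ->
    measure_function.semi_additive lam ->
    (forall B, measurable B -> B `<=` A -> `|mu B| <= lam B) ->
  set_function_variation mu A <= lam A.
Proof.
move=> mA addlam mulam; apply: ge_ereal_sup => _ [F [k [mF tF FA ->]]].
rewrite -FA addlam// ?FA//; apply: lee_sum => i _; apply: mulam => //.
by rewrite -FA; exact: (@bigsetU_sup _ _ _ F).
Qed.

(** Trades partition sums for vanishing on measurable subsets, the form in which null sets are
    handled below. *)
Lemma variation0P mu A : measurable A ->
  set_function_variation mu A = 0 <->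
  forall B, measurable B -> B `<=` A -> mu B = 0.
Proof.
move=> mA; split=> [A0 B mB BA|mu0].
  by apply/eqP; rewrite -abse_eq0 eq_le abse_ge0 -A0 abse_le_variation.
apply/eqP; rewrite eq_le variation_ge0// andbT.
apply: (@variation_le mu (fun=> 0)) => //.
  by move=> F n _ _ _; rewrite big1.
by move=> B mB BA; rewrite mu0// abse0.
Qed.

Lemma variation_set0 (mu : {additive_charge set T -> \bar R}) :
  set_function_variation mu set0 = 0.
Proof.
apply/variation0P => // B _; rewrite subset0 => ->.
(* Additivity over the empty family yields [mu set0 = 0]. *)
have := @charge_semi_additive _ _ _ mu (fun=> set0) 0%N.
by rewrite !big_ord0; apply => //; exact: trivIset_set0.
Qed.

Lemma additive_chargeU (mu : {additive_charge set T -> \bar R}) A B :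
  measurable A -> measurable B -> A `&` B = set0 -> mu (A `|` B) = mu A + mu B.
Proof.
move=> mA mB AB0; rewrite -bigsetU_bigcup2 charge_semi_additive//.
- by rewrite !big_ord_recl big_ord0 /= adde0.
- by move=> [|[|i]] /=.
- by rewrite -trivIset_bigcup2.
- by rewrite bigsetU_bigcup2; exact: measurableU.
Qed.

Lemma variationU0 (mu : {additive_charge set T -> \bar R}) A B :
    measurable A -> measurable B ->
    set_function_variation mu A = 0 -> set_function_variation mu B = 0 ->
  set_function_variation mu (A `|` B) = 0.
Proof.
move=> mA mB /(variation0P _ mA) A0 /(variation0P _ mB) B0.
apply/variation0P; first exact: measurableU.
move=> D mD DAB; rewrite -(setUIDK D A) additive_chargeU.
- rewrite A0 ?B0 ?adde0//; first exact: measurableD.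
    by move=> x [/DAB[]].
  exact: measurableI.
- exact: measurableI.
- exact: measurableD.
- by rewrite setDE setIACA setICr setI0.
Qed.

Lemma variation_bigsetU0 (mu : {additive_charge set T -> \bar R})
    (F : (set T)^nat) n :
    (forall k, measurable (F k)) ->
    (forall k, set_function_variation mu (F k) = 0) ->
  set_function_variation mu (\big[setU/set0]_(k < n) F k) = 0.
Proof.
move=> mF F0; elim: n => [|n IHn].
  by rewrite big_ord0 variation_set0.
by rewrite big_ord_recr /=; apply: variationU0 => //; exact: bigsetU_measurable.
Qed.

Lemma meet_variation_ge0 mu nu A : measurable A ->
  0 <= set_function_meet (set_function_variation mu)
         (set_function_variation nu) A.
Proof.
move=> mA; apply: le_ereal_inf_tmp => _ [B [mB _ ->]].
by rewrite adde_ge0// variation_ge0//; exact: measurableD.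
Qed.

(** In the infimum, the competitor [A' = A]&[E] costs nothing for [mu] and leaves [A]\[E] to
    [nu]. *)
Lemma meet_variation_le mu nu A E : measurable A -> measurable E ->
    set_function_variation mu E = 0 ->
  set_function_meet (set_function_variation mu) (set_function_variation nu) A
  <= set_function_variation nu (A `\` E).
Proof.
move=> mA mE /(variation0P _ mE) E0; apply: ereal_inf_lbound.
exists (A `&` E); split; [exact: measurableI|by move=> x []|].
have mAE : measurable (A `&` E) by exact: measurableI.
have /(variation0P _ mAE) -> :
    forall B, measurable B -> B `<=` A `&` E -> mu B = 0.
  by move=> B mB BAE; apply: E0 => // x /BAE[].
by rewrite add0e setDIr setDv set0U.
Qed.

End variation.

(** * Second countability of R^n *)

Section second_countable.
Context {R : realType} {n : nat}.

Lemma rV_countable_basis : exists B : (set 'rV[R]_n)^nat,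
  (forall k, open (B k)) /\
  forall (V : set 'rV[R]_n) x, open V -> V x -> exists2 k, B k x & B k `<=` V.
Proof.
pose ctr (q : 'rV[rat]_n) : 'rV[R]_n := map_mx ratr q.
pose nbh (p : 'rV[rat]_n * nat) := ball (ctr p.1) (p.2.+1%:R^-1)%R.
(* Balls with rational centres and radii 1/(N+1), enumerated by [pickle]; numbers coding no pair get
   the empty set. *)
exists (fun k => if unpickle k is Some p then nbh p else set0); split.
  by move=> k; case: unpickle => [p|]; [exact: ball_open|exact: open0].
move=> V x oV Vx.
have /nbhs_ballP[e /= e0 eV] : nbhs x V by exact: open_nbhs_nbhs.
have e20 : (0 < e / 2)%R by rewrite divr_gt0.
(* As 1/(N+1) < e/2, a ball of this radius that contains x lies in the e-ball around x. *)
have [N _ /(_ N (leqnn N)) /= Ne] := near_infty_natSinv_lt (PosNum e20).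
have N0 : (0 < N.+1%:R^-1 :> R)%R by rewrite invr_gt0.
have /choice[q qx] : forall i : 'I_n, exists q : rat,
    (`|ratr q - x ord0 i| < N.+1%:R^-1)%R.
  move=> i; have [|q] := @rat_in_itvoo R (x ord0 i - N.+1%:R^-1)
      (x ord0 i + N.+1%:R^-1).
    by rewrite ltrD2l gtrN.
  by rewrite in_itv /= => qi; exists q; rewrite ltr_distl.
pose p : 'rV[rat]_n * nat := (\row_i q i, N)%R.
have px : ball (ctr p.1) N.+1%:R^-1 x.
  by split => // i j; rewrite !mxE ord1; exact: qx.
exists (pickle p); rewrite pickleK //.
move=> y py; apply: eV.
apply: (@le_ball _ _ _ (N.+1%:R^-1 + N.+1%:R^-1)%R).
  by rewrite [leRHS]splitr lerD// ltW.
by apply: ball_triangle py; exact: ball_sym.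
Qed.

End second_countable.

(** * Borel subsets of Omega and countably additive charges on them *)

Section borel_on.
Context {R : realType} {n : nat}.
Implicit Type Omega : set 'rV[R]_n.

Let Rn : measurableType _ := g_sigma_algebraType (@open 'rV[R]_n).

Lemma measurable_borel_on Omega (A : set 'rV[R]_n) : borel Omega -> borel A ->
  measurable (A `&` Omega : set (borel_on Omega)).
Proof. by move=> bO bA; split=> [|x []//]; exact: (@measurableI _ Rn). Qed.

Lemma lebesgue_rV_null_sub (A B : set 'rV[R]_n) : A `<=` B -> lebesgue_rV B = 0 ->
  lebesgue_rV A = 0.
Proof.
move=> AB B0; apply/eqP; rewrite eq_le; apply/andP; split.
  rewrite -B0; apply: le_ereal_inf => _ [D [a [b [ab BD ->]]]].
  by exists D, a, b; split=> //; exact: subset_trans BD.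
apply: le_ereal_inf_tmp => _ [D [a [b [ab _ ->]]]].
apply: esum_ge0 => k Dk; rewrite lee_fin.
by apply: prodr_ge0 => i _; rewrite subr_ge0 ab.
Qed.

Section trace.
Variables (Omega : set 'rV[R]_n) (bO : borel Omega).
Variable nu : {charge set (borel_on Omega) -> \bar R}.

(* The argument bO is not used in the body: it lets the charge instance below,
   which needs Omega to be Borel, be inferred from the term. *)
Definition charge_trace (bO : borel Omega) (B : set Rn) : \bar R :=
  nu (B `&` Omega).

Let trace0 : charge_trace bO set0 = 0.
Proof. by rewrite /charge_trace set0I charge0. Qed.

Let trace_fin B : measurable B -> charge_trace bO B \is a fin_num.
Proof. by move=> mB; exact/fin_num_measure/measurable_borel_on. Qed.

Let trace_sigma_additive : semi_sigma_additive (charge_trace bO).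
Proof.
move=> F mF tF mUF; rewrite /charge_trace setI_bigcupl.
apply: charge_semi_sigma_additive.
- by move=> i; exact: measurable_borel_on bO (mF i).
- exact: trivIset_setIr.
- by rewrite -setI_bigcupl; exact: measurable_borel_on bO mUF.
Qed.

HB.instance Definition _ := isCharge.Build _ Rn R (charge_trace bO)
  trace0 trace_fin trace_sigma_additive.

(** [borel_on Omega] is a sigma-ring in which the whole space need not be measurable, so the Hahn
    decomposition is applied to the trace charge on all Borel sets of R^n; its variation is the
    finite measure [lam]. *)
Lemma variation_charge_le : exists2 lam : {measure set Rn -> \bar R},
  (forall A, measurable A -> lam A < +oo) &
  forall A : set (borel_on Omega), measurable A ->
    set_function_variation nu A <= lam A.
Proof.
have [P [N PN]] := Hahn_decomposition (charge_trace bO).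
exists (charge_variation PN) => A.
  by move=> mA; rewrite ltey_eq fin_num_measure.
move=> mA; apply: variation_le => //.
  move=> F k mF tF _; rewrite (@measure_semi_additive _ Rn)//.
    by move=> i; case: (mF i).
  by apply: bigsetU_measurable => i _; case: (mF i).
move=> B [bB BO] _; have -> : nu B = charge_trace bO B by rewrite /charge_trace setIidl.
exact: abse_charge_variation.
Qed.

End trace.

(** Continuity from above of the dominating finite measure squeezes [c]. *)
Lemma variation_charge_vanish Omega (nu : {charge set (borel_on Omega) -> \bar R})
    (F : (set (borel_on Omega))^nat) (c : \bar R) :
    borel Omega -> (forall k, measurable (F k)) ->
    nonincreasing_seq F -> \bigcap_k F k = set0 ->
    (forall k, c <= set_function_variation nu (F k)) ->
  c <= 0.
Proof.
move=> bO mF niF F0 cF; have [lam lamoo nulam] := variation_charge_le bO nu.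
have mF' k : measurable (F k : set Rn) by case: (mF k).
have : lam \o F @ \oo --> lam (\bigcap_k F k).
  apply: nonincreasing_cvg_mu => //; first exact: lamoo.
  by rewrite F0.
rewrite F0 measure0; apply: cvge_ge.
by apply: nearW => k; exact: le_trans (nulam _ (mF k)).
Qed.

(** An open set around a limit point of the core is also a neighbourhood of some core point. This
    makes the core Borel. *)
Lemma closed_core Omega (mu : set (borel_on Omega) -> \bar R) :
  closed (core mu).
Proof.
move=> x clx V oV Vx; have [y [cy Vy]] := clx V (open_nbhs_nbhs (conj oV Vx)).
exact: cy.
Qed.

End borel_on.

(** * Exhaustion of Omega by null sets of the variation of [mu] *)

Theorem proposition3p30 (R : realType) (n : nat) (Omega : set 'rV[R]_n)
    (mu : {additive_charge set (borel_on Omega) -> \bar R}) :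
  borel Omega ->
  in_ba_lebesgue mu ->
  lebesgue_rV (core mu `&` Omega) = 0 ->
  pure mu.
Proof.
move=> bO [_ mu_ac] core0 nu _ A mA.
have b_open (V : set 'rV[R]_n) : open V -> borel V.
  exact: sub_sigma_algebra.
have b_core : borel (core mu).
  rewrite -(setCK (core mu)).
  apply: (@measurableC _ (g_sigma_algebraType (@open 'rV[R]_n))).
  by apply: b_open; rewrite openC; exact: closed_core.
have [B [oB basisB]] := @rV_countable_basis R n.
pose null (V : set 'rV[R]_n) := set_function_variation mu (V `&` Omega) = 0.
(* Index 0 holds the core; index j+1 holds [B j] if it is null for the variation, and the empty set
   otherwise. *)
pose W k := if k is j.+1 then if `[< null (B j) >] then B j else set0
            else core mu.
pose F k : set (borel_on Omega) := W k `&` Omega.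
have mF k : measurable (F k).
  apply: measurable_borel_on => //.
  by case: k => [|k] //=; case: ifP => _; apply: b_open => //; exact: open0.
have F0 k : set_function_variation mu (F k) = 0.
  case: k (mF k) => [mF0|k].
    apply/variation0P => // D mD /lebesgue_rV_null_sub D0.
    by apply: mu_ac => //; exact: D0.
  rewrite /F /=; case: asboolP => // _.
  by rewrite set0I variation_set0.
have FO : Omega `<=` \bigcup_k F k.
  (* Core points lie in [F 0]. Any other point has a null open neighbourhood V, and a basis set
     inside V inherits nullity. *)
  move=> x Ox; have [cx|/existsNP[V /not_implyP[oV /not_implyP[Vx]]]] :=
    pselect (core mu x); first by exists 0%N.
  have mV : measurable (V `&` Omega : set (borel_on Omega)).
    by apply: measurable_borel_on => //; exact: b_open.
  move/negP; rewrite -leNgt => V0.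
  have {}V0 : null V by apply/eqP; rewrite eq_le V0 variation_ge0.
  have [k Bx BV] := basisB V x oV Vx.
  have nB : null (B k).
    apply/variation0P; first by apply: measurable_borel_on => //; exact: b_open.
    move=> D mD DB; move/(variation0P mu mV): V0; apply => // y /DB[/BV Vy Oy].
    by split.
  by exists k.+1 => //; split=> //=; case: asboolP.
apply/eqP; rewrite eq_le meet_variation_ge0// andbT.
pose E k := \big[setU/set0]_(i < k) F i.
have mE k : measurable (E k) by exact: bigsetU_measurable.
(* Here [c] is the meet at A, which does not depend on k. *)
apply: (@variation_charge_vanish _ _ _ nu (fun k => A `\` E k)) => //.
- by move=> k; exact: measurableD.
- move=> i j ij; apply/subsetPset; apply: setDS.
  exact: (@subset_bigsetU _ F).
- rewrite -subset0 => x AEx; have [Ax _] := AEx 0%N I.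
  have [k _ Fkx] := FO _ (mA.2 _ Ax).
  (* [E k] stops before [F k], so x is caught only at index k+1. *)
  have [_ []] := AEx k.+1 I.
  by rewrite /E big_ord_recr /=; right.
- by move=> k; apply: meet_variation_le => //; exact: variation_bigsetU0.
Qed.
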